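(* Let $m\ge 0$ be an integer, and let $\mathcal{T}$ be an arbitrary finite tree with vertex set $\mathcal{V}$ and geodesic distance $\mathcal{S}$. Let $\mathcal{S}^{\star}_{1}$ be the geodesic distance of the $(1,m)$-star-fractal tree $\mathcal{T}^{\star}_{1}$ of $\mathcal{T}$. Then $$\mathcal{S}^{\star}_{1}=2(m+2)^{2}\mathcal{S}-(m+2)(|\mathcal{V}|-1)(m+|\mathcal{V}|).$$
   Context: The geodesic distance of a finite connected graph $\mathcal{G}$ with vertex set $\mathcal{V}$ is the total $\mathcal{S}=\sum_{\{u,v\}} d_{uv}$, summed over all unordered pairs of distinct vertices $u,v\in\mathcal{V}$, where $d_{uv}$ is the number of edges of a shortest path joining $u$ and $v$. The $(1,m)$-star-fractal operation on a graph does the following to every edge $uv$: it inserts a new vertex $w$ into the edge (replacing $uv$ by the path $uwv$), and attaches $m$ further new vertices $w_1,\dots,w_m$ to $w$, each by an edge to $w$ (all new vertices distinct for distinct edges). The resulting graph is the $(1,m)$-star-fractal graph (tree) of the original graph. The case $m=0$ is first-order subdivision (no vertices $w_i$ are attached). *)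

(* Defs.v *)
From mathcomp Require Import all_boot all_order all_algebra.

Set Implicit Arguments.
Unset Strict Implicit.
Unset Printing Implicit Defensive.

Record sgraph := SGraph {
  vertex :> finType;
  adj : rel vertex;
  adj_sym : symmetric adj;
  adj_irrefl : irreflexive adj }.

Definition edges (G : sgraph) : {set {set G}} :=
  [set A | [exists u : G, exists v : G, adj u v && (A == [set u; v])]].

Definition edge (G : sgraph) : finType := {A : {set G} | A \in edges G}.

Definition connected_graph (G : sgraph) : Prop :=
  0 < #|G| /\ forall u v : G, connect (@adj G) u v.

(* [ucycle] accepts the sequences [::] and, for an edge xy, [:: x; y]; cycles
   in the sense of graph theory are those with at least three vertices. *)
Definition acyclic_graph (G : sgraph) : Prop :=
  forall c : seq G, ucycle (@adj G) c -> size c < 3.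

Definition is_tree (G : sgraph) : Prop :=
  connected_graph G /\ acyclic_graph G.

(* The path u :: p from u to v has no repeated vertex and size p edges. *)
Definition path_between (G : sgraph) (u v : G) (p : seq G) : bool :=
  [&& path (@adj G) u p, last u p == v & uniq (u :: p)].

(* The least length of a path from u to v, which is less than #|G|; the value
   is #|G| when there is no such path. *)
Definition dist (G : sgraph) (u v : G) : nat :=
  find (fun k => [exists p : k.-tuple G, path_between u v p]) (iota 0 #|G|).

Lemma distP (G : sgraph) (u v : G) : connect (@adj G) u v ->
  (exists2 p, path_between u v p & size p = dist u v) /\
  (forall p, path_between u v p -> dist u v <= size p).
Proof.
set P := fun k => [exists p : k.-tuple G, path_between u v p].
have ltP p : path_between u v p -> size p < #|G|.
  by case/and3P=> _ _ /card_uniqP /= <-; apply: max_card.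
have inP p : path_between u v p -> P (size p).
  by move=> Hp; apply/existsP; exists (in_tuple p).
have leP p : path_between u v p -> dist u v <= size p.
  move=> Hp; rewrite leqNgt; apply/negP=> /(before_find 0).
  by rewrite nth_iota ?ltP // add0n; move: (inP p Hp); rewrite /P => ->.
move=> /connectP [q Hq Hv]; split=> //.
have [p Hp _] : exists2 p, path_between u v p & true.
  case/shortenP: Hq Hv => p Hp Up _ ->.
  by exists p; rewrite // /path_between Hp eqxx Up.
have hasP_ : has P (iota 0 #|G|).
  by apply/hasP; exists (size p); rewrite ?inP // mem_iota ltP.
have := nth_find 0 hasP_.
rewrite nth_iota; last by move: hasP_; rewrite has_find size_iota.
by move=> /existsP [t Ht]; exists t => //; rewrite size_tuple.
Qed.

(* Each unordered pair of distinct vertices is counted once, in the order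
   given by the enumeration of the vertices. *)
Definition geodesic_distance (G : sgraph) : nat :=
  \sum_(u : G) \sum_(v : G | enum_rank u < enum_rank v) dist u v.

(* Vertices: those of G (inl u), the vertex inserted into the edge a
   (inr (inl a)), and its m pendant neighbours (inr (inr (a, i))). *)
Definition star_vertex (m : nat) (G : sgraph) : finType :=
  (G + (edge G + edge G * 'I_m))%type.

Definition star_adj (m : nat) (G : sgraph) : rel (star_vertex m G) :=
  fun x y =>
    match x, y with
    | inl u, inr (inl a) => u \in val a
    | inr (inl a), inl u => u \in val a
    | inr (inl a), inr (inr (b, _)) => a == b
    | inr (inr (b, _)), inr (inl a) => a == b
    | _, _ => false
    end.

Lemma star_adj_sym (m : nat) (G : sgraph) : symmetric (@star_adj m G).
Proof. by case=> [u|[a|[a i]]] [v|[b|[b j]]]. Qed.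

Lemma star_adj_irrefl (m : nat) (G : sgraph) : irreflexive (@star_adj m G).
Proof. by case=> [u|[a|[a i]]]. Qed.

Definition star_fractal (m : nat) (G : sgraph) : sgraph :=
  SGraph (@star_adj_sym m G) (@star_adj_irrefl m G).

(* Main.v *)
Require Import Defs.
From mathcomp Require Import all_boot all_order all_algebra.
From mathcomp Require Import zify ring.

(** Write n for the number of vertices of the tree T, e = n - 1 for its number
of edges, D(u) for the sum of the distances from u, and W for the sum of all
D(u), that is, twice the geodesic distance.  The proof computes the sum of the
distances from each vertex of the star-fractal tree and adds these up; ordered
pairs are used throughout, so that the sums factor.

Seen from a vertex u, each edge of T joins a vertex at distance d - 1 to one at
distance d, and each vertex other than u is the far end of exactly one edge
([sum_far_end]).  Hence, over the edges a = xy,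
  sum_a (d(u,x) + d(u,y)) = sum_(v <> u) (2 d(u,v) - 1) = 2 D(u) - e,
which is [sum_edge_sum_dist].  It lets every sum over edges below be
eliminated.

In the star-fractal tree the distances double, and an inserted vertex lies
halfway between the two ends of its edge.  From an old vertex u:
  2 d(u,v) to the old vertex v, and d(u,x) + d(u,y) to the centre of xy.
From the centre of b = st, put g(v) = d(s,v) + d(t,v); then the distances are
  g(v) to the old vertex v, and (g(x) + g(y))/2 to the centre of another edge.
The second formula holds because s and t agree on which end of xy is the nearer
one ([parallel_edges]), so that g changes by exactly 2 along xy.  Along b itself
g is constantly 1, whence an error of 1 in the formula for a = b.
A pendant vertex is one step further than its centre, both as source and as
target.

Summing, with N the number of vertices of the star-fractal tree, the sum of the
distances is
  (2m + 4) D(u) - e                           from u,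
  (m + 2) (D(s) + D(t)) + m e - (m + 1) n     from the centre of st,
  the latter plus N - 2                       from a pendant vertex at st.
The sum of D(s) + D(t) over all edges st is again given by
[sum_edge_sum_dist]: it is 2 W - n e.  The theorem follows by algebra.

All distances are identified by one principle, [distance_from_dist]: a function
that vanishes at u, grows by at most 1 along an edge, and can be decreased by 1
at each vertex other than u by moving to a neighbour, is the distance from u. *)

Set Implicit Arguments.
Unset Strict Implicit.
Unset Printing Implicit Defensive.

(** * Recognising distance functions *)

Definition distance_from (G : sgraph) (u : G) (f : G -> nat) : Prop :=
  [/\ f u = 0,
      forall x y, adj x y -> f y <= (f x).+1 &
      forall v, v != u -> exists2 w, adj w v & f v = (f w).+1].

(** The relation is arbitrary, so that this applies as well to a graph from which
an edge has been removed, with the distance function of the whole graph. *)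
Lemma descent_walk (T : finType) (e : rel T) (u : T) (f : T -> nat) :
  (forall v, v != u -> exists2 w, e w v & f w < f v) ->
  forall v, exists p, [/\ path e u p, last u p = v & size p <= f v].
Proof.
move=> desc v; have [n] := ubnP (f v); elim: n v => // n IHn v lt_fv_n.
have [->|/desc [w ewv lt_fw]] := eqVneq v u; first by exists [::].
have [|p [up lp sp]] := IHn w; first by lia.
exists (rcons p v); rewrite rcons_path up lp ewv last_rcons size_rcons.
by split=> //; lia.
Qed.

Lemma dist_le_walk (G : sgraph) (u : G) (p : seq G) :
  path (@adj G) u p -> dist u (last u p) <= size p.
Proof.
move=> up; have uv : connect (@adj G) u (last u p) by apply/connectP; exists p.
have [_] := distP uv; case/shortenP: up => q uq Uq sub_qp le_dist.
have := le_dist q; rewrite /path_between uq eqxx Uq => /(_ isT) /leq_trans; apply.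
by case/andP: Uq => _ Uq; apply: uniq_leq_size.
Qed.

(** Descending along f yields a walk to u of length f v; conversely f grows by at
most one per step, so that no walk can be shorter. *)
Lemma distance_from_dist (G : sgraph) (u : G) (f : G -> nat) :
  distance_from u f -> dist u =1 f.
Proof.
case=> f0 lip desc v; apply/eqP; rewrite eqn_leq; apply/andP; split.
  have [|p [up <-]] := @descent_walk _ (@adj G) u f _ v; last first.
    by apply: leq_trans; apply: dist_le_walk.
  by move=> x /desc [w xw ->]; exists w.
have uv : connect (@adj G) u v.
  have [|p [up <- _]] := @descent_walk _ (@adj G) u f _ v.
    by move=> x /desc [w xw ->]; exists w.
  by apply/connectP; exists p.
have [[p /and3P [up /eqP <- _] <-] _] := distP uv.
elim/last_ind: p up => [|p x IHp]; first by rewrite /= f0.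
rewrite rcons_path last_rcons size_rcons => /andP [/IHp le_p /lip].
by move=> /leq_trans; apply.
Qed.

Lemma dist_distance_from (G : sgraph) (u : G) :
  (forall v, connect (@adj G) u v) -> distance_from u (dist u).
Proof.
move=> conn.
have dist_uu : dist u u = 0.
  by apply/eqP; rewrite -leqn0; apply: (@dist_le_walk _ u [::]).
have lip x y : adj x y -> dist u y <= (dist u x).+1.
  move=> xy; have [[p /and3P [up /eqP lp _] <-] _] := distP (conn x).
  have := @dist_le_walk _ u (rcons p y).
  by rewrite rcons_path up lp xy last_rcons size_rcons; apply.
split=> // v neq_vu.
have [[p /and3P [up /eqP lp _] eq_d] _] := distP (conn v).
case/lastP: p up lp eq_d => [_ /= uv|p x]; first by rewrite uv eqxx in neq_vu.
rewrite rcons_path last_rcons size_rcons => /andP [up adj_x] eq_xv eq_d.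
rewrite {x}eq_xv in adj_x *.
exists (last u p) => //; apply/eqP; rewrite eqn_leq lip //=.
by rewrite -eq_d ltnS dist_le_walk.
Qed.

Lemma dist_sym (G : sgraph) (u v : G) : dist u v = dist v u.
Proof.
have rev_between (x y : G) p :
  path_between x y p -> path_between y x (rev (belast x p)).
  case/and3P=> xp /eqP <- Up; apply/and3P; split.
  - by rewrite rev_path (eq_path (e' := @adj G)) // => a b; rewrite adj_sym.
  - by case: p {xp Up} => //= z p; rewrite rev_cons last_rcons.
  - by rewrite -rev_rcons -lastI rev_uniq.
apply: eq_find => k; apply/existsP/existsP => -[p /rev_between p_btw].
  have sz : size (rev (belast u p)) == k by rewrite size_rev size_belast size_tuple.
  by exists (Tuple sz).
have sz : size (rev (belast v p)) == k by rewrite size_rev size_belast size_tuple.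
by exists (Tuple sz).
Qed.

(** Every path leaving a pendant vertex l goes through its only neighbour w. *)
Lemma pendant_distance_from (G : sgraph) (l w : G) (f : G -> nat) :
  (forall z, adj l z = (z == w)) -> distance_from w f ->
  distance_from l (fun z => if z == l then 0 else (f z).+1).
Proof.
move=> adj_l [f0 lip desc].
have neq_wl : w != l.
  by apply: contraFneq (adj_irrefl l) => eq_wl; rewrite adj_l eq_wl.
split=> [|x y xy|v neq_vl]; first by rewrite eqxx.
  case: (eqVneq y l) => // neq_yl; case: (eqVneq x l) => [eq_xl|_].
    by move: xy; rewrite eq_xl adj_l => /eqP ->; rewrite f0.
  by rewrite ltnS lip.
rewrite (negbTE neq_vl); have [->|neq_vw] := eqVneq v w.
  by exists l; rewrite ?adj_l ?eqxx ?f0.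
have [x xv ->] := desc v neq_vw; exists x => //.
case: (eqVneq x l) => // eq_xl.
by move: xv; rewrite eq_xl adj_l (negbTE neq_vw).
Qed.

(** Passing to ordered pairs removes the dependence on the enumeration of the
vertices. *)
Lemma sum_dist (G : sgraph) :
  (forall u : G, dist u u = 0) ->
  \sum_(u : G) \sum_(v : G) dist u v = 2 * geodesic_distance G.
Proof.
move=> dist0; rewrite mul2n -addnn /geodesic_distance.
rewrite [X in _ = _ + X](exchange_big_dep xpredT) //= -big_split /=.
apply: eq_bigr => u _; rewrite (bigD1 u) //= dist0 add0n.
rewrite (bigID (fun v => enum_rank u < enum_rank v)) /=; congr (_ + _).
  apply: eq_bigl => v; rewrite andb_idl //.
  by apply: contraTneq => ->; rewrite ltnn.
apply: eq_big => [v|v _]; last exact: dist_sym.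
by rewrite -leqNgt ltn_neqAle (inj_eq val_inj) (inj_eq enum_rank_inj).
Qed.

(** * Edges *)

Definition edge_sum (G : sgraph) (f : G -> nat) (a : edge G) : nat :=
  \sum_(x in val a) f x.

Lemma edgeE (G : sgraph) (a : edge G) :
  exists x y, adj x y /\ val a = [set x; y].
Proof.
case: a => A /= ; rewrite inE => /existsP [x /existsP [y /andP [xy /eqP eqA]]].
by exists x, y.
Qed.

Lemma adj_edge (G : sgraph) (x y : G) :
  adj x y -> exists a : edge G, val a = [set x; y].
Proof.
move=> xy; suff edge_xy : [set x; y] \in edges G by exists (exist (fun A => A \in edges G) _ edge_xy).
by rewrite inE; apply/existsP; exists x; apply/existsP; exists y; rewrite xy /=.
Qed.

Lemma adj_neq (G : sgraph) (x y : G) : adj x y -> x != y.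
Proof. by move=> xy; apply: contraTneq xy => ->; rewrite adj_irrefl. Qed.

Lemma edge_sumE (G : sgraph) (f : G -> nat) (a : edge G) (x y : G) :
  adj x y -> val a = [set x; y] -> edge_sum f a = f x + f y.
Proof.
by move=> xy eqa; rewrite /edge_sum eqa big_setU1 ?big_set1 // inE adj_neq.
Qed.

Lemma edge_sum_exchange (G : sgraph) (I : finType) (F : G -> I -> nat) a :
  edge_sum (fun x => \sum_(i : I) F x i) a =
  \sum_(i : I) edge_sum (F^~ i) a.
Proof. exact: exchange_big. Qed.

(** * Metric structure of trees *)

(** A path from x to y avoiding the edge xy would be closed by it to a cycle. *)
Lemma tree_bridge (T : sgraph) (x y : T) : acyclic_graph T -> adj x y ->
  ~~ connect (fun a b => adj a b && ([set a; b] != [set x; y])) x y.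
Proof.
move=> acyc xy; apply/negP => /connectP [p xp].
case/shortenP: xp => q xq Uq _ lq.
have := acyc (x :: q); rewrite /ucycle Uq andbT /= rcons_path -lq adj_sym xy andbT.
rewrite (sub_path _ xq) => [/(_ isT)|a b /andP [] //].
case: q xq Uq lq => [|z [|? ?]] //= xq Uq eq_y _.
  by move: xy; rewrite eq_y adj_irrefl.
by move: xq; rewrite eq_y eqxx !andbF.
Qed.

Section Tree.

Variables (T : sgraph) (hT : is_tree T).

Let conn (u v : T) : connect (@adj T) u v. Proof. by case: hT => -[]. Qed.
Let acyc : acyclic_graph T. Proof. by case: hT. Qed.

Lemma tree_dist (u : T) : distance_from u (dist u).
Proof. exact: dist_distance_from. Qed.

Lemma tree_distxx (u : T) : dist u u = 0.
Proof. by case: (tree_dist u). Qed.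

Lemma tree_dist_lip (u x y : T) : adj x y -> dist u y <= (dist u x).+1.
Proof. by case: (tree_dist u) => _ lip _; apply: lip. Qed.

Lemma tree_dist_eq0 (u v : T) : dist u v = 0 -> v = u.
Proof.
case: (tree_dist u) => _ _ desc d0; apply/eqP; apply: contra_eqT d0 => /desc.
by case=> w _ ->.
Qed.

(** If every vertex could get closer to u without using the edge xy, then both x
and y would remain connected to u after its removal, contradicting
[tree_bridge].  Both basic facts below, that distances differ along an edge and
that the nearer neighbour is unique, are proved by exhibiting such a descent. *)
Lemma descent_uses_edge (u x y : T) : adj x y ->
  ~ (forall v, v != u -> exists w, [/\ adj w v, [set w; v] != [set x; y] &
                                     dist u w < dist u v]).
Proof.
move=> xy desc; set e := fun a b => adj a b && ([set a; b] != [set x; y]).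
have sym_e : symmetric e by move=> a b; rewrite /e adj_sym setUC.
have e_u v : connect e u v.
  have [|p [up <- _]] := @descent_walk _ e u (dist u) _ v.
    by move=> z /desc [w [wz neq lt_w]]; exists w; rewrite // /e wz.
  by apply/connectP; exists p.
have /negP := tree_bridge acyc xy; apply.
by apply: connect_trans (e_u y); rewrite (sym_connect_sym sym_e).
Qed.

Lemma adj_dist_neq (u x y : T) : adj x y -> dist u x != dist u y.
Proof.
move=> xy; apply/eqP => eq_d; apply: (@descent_uses_edge u x y xy) => v.
case: (tree_dist u) => _ _ desc /desc [w wv dv]; exists w; split=> //; last by rewrite dv.
apply/eqP=> eqE.
have: w \in [set x; y] by rewrite -eqE !inE eqxx.
have: v \in [set x; y] by rewrite -eqE !inE eqxx orbT.
by rewrite !inE => /orP [] /eqP ? /orP [] /eqP ?; subst; lia.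
Qed.

Lemma tree_parent_unique (u v x y : T) : adj x v -> adj y v ->
  dist u x < dist u v -> dist u y < dist u v -> x = y.
Proof.
move=> xv yv ltx lty; apply/eqP; apply/negP => /negP neq_xy.
apply: (@descent_uses_edge u x v xv) => w neq_wu.
have [->|neq_wv] := eqVneq w v.
  exists y; split=> //; apply/eqP => /setP /(_ y).
  by rewrite !inE eqxx (eq_sym y x) (negbTE neq_xy) (negbTE (adj_neq yv)).
case: (tree_dist u) => _ _ desc; have [z zw dw] := desc w neq_wu.
exists z; split=> //; last by rewrite dw.
apply/eqP=> eqE; have: w \in [set x; v] by rewrite -eqE !inE eqxx orbT.
rewrite !inE (negbTE neq_wv) orbF => /eqP ?; subst w.
have: v \in [set z; x] by rewrite eqE !inE eqxx orbT.
by rewrite !inE => /orP [] /eqP ?; subst; lia.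
Qed.

Lemma edge_orient (u : T) (a : edge T) :
  exists x y, [/\ adj x y, val a = [set x; y] & dist u y = (dist u x).+1].
Proof.
have [x [y [xy eqa]]] := edgeE a; have := adj_dist_neq u xy.
have yx : adj y x by rewrite adj_sym.
have := tree_dist_lip u xy; have := tree_dist_lip u yx => le1 le2 neq.
have [lt|ge] := ltnP (dist u x) (dist u y).
  by exists x, y; split=> //; lia.
by exists y, x; split; rewrite // 1?setUC //; lia.
Qed.

(** Mapping an edge to its end far from u is a bijection from the edges to the
vertices other than u; its inverse maps v to the edge towards its unique
nearer neighbour. *)
Lemma sum_far_end (u : T) (F : T -> nat) (H : edge T -> nat) :
  (forall a x y, adj x y -> val a = [set x; y] -> dist u y = (dist u x).+1 ->
     H a = F y) ->
  \sum_(a : edge T) H a = \sum_(v | v != u) F v.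
Proof.
move=> HF.
pose P (a : edge T) v := (v \in val a) && [exists x in val a, dist u x < dist u v].
(* P a v says that v is the far end of a. *)
transitivity (\sum_(a : edge T) \sum_(v | P a v) F v).
  apply: eq_bigr => a _; have [x [y [xy eqa dy]]] := edge_orient u a.
  rewrite (HF a x y) // (big_pred1 y) // => v; rewrite /P eqa !inE.
  apply/andP/eqP => [[/orP [] /eqP -> //]|->]; last first.
    by split; [rewrite eqxx orbT|apply/existsP; exists x; rewrite !inE eqxx dy /=].
  case/existsP=> z; rewrite !inE => /andP [/orP [] /eqP ->]; lia.
rewrite (exchange_big_dep (fun v => v != u)) /=; last first.
  move=> a v _ /andP [_ /existsP [x /andP [_]]].
  by case: (eqVneq v u) => // ->; rewrite tree_distxx.
apply: eq_bigr => v neq_vu; case: (tree_dist u) => _ _ desc.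
have [w wv dv] := desc v neq_vu; have [a eqa] := adj_edge wv.
rewrite (big_pred1 a) // => b; rewrite /P; apply/andP/eqP => [|->]; last first.
  split; first by rewrite eqa !inE eqxx orbT.
  by apply/existsP; exists w; rewrite eqa !inE eqxx dv /=.
case=> vb /existsP [z /andP [zb lt_z]]; apply: val_inj; rewrite eqa.
have [x [y [xy eqb dy]]] := edge_orient u b.
move: vb zb; rewrite eqb !inE => /orP [] /eqP ? /orP [] /eqP ?; subst; try lia.
by rewrite (@tree_parent_unique u y w x) //; lia.
Qed.

Lemma card_edge : #|edge T| = #|T|.-1.
Proof.
have [[/card_gt0P [u _] _] _] := hT.
rewrite -sum1_card (@sum_far_end u (fun=> 1)) // sum1_card.
by rewrite (cardC1 u).
Qed.

(** The ends of an edge with far end v contribute 2 d(u,v) - 1. *)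
Lemma sum_edge_sum_dist (u : T) :
  \sum_(a : edge T) edge_sum (dist u) a + #|edge T| = 2 * \sum_v dist u v.
Proof.
rewrite -sum1_card -big_split /= (@sum_far_end u (fun v => 2 * dist u v)).
  by rewrite -big_distrr /= [in RHS](bigD1 u) //= tree_distxx add0n.
by move=> a x y xy eqa dy; rewrite (edge_sumE _ xy eqa); lia.
Qed.

(** Otherwise d(s,x) = d(t,y) = k and d(s,y) = d(t,x) = k + 1.  If k = 0 the two
edges coincide.  If not, the neighbour p of s towards x is also nearer to y than
s is, as is t; so p = t, but then d(t,x) = k - 1. *)
Lemma parallel_edges (s t x y : T) : adj s t -> adj x y ->
  [set s; t] != [set x; y] -> dist s y = (dist s x).+1 -> dist t y = (dist t x).+1.
Proof.
move=> st xy neqE ds; apply/eqP; apply: contraNT neqE => /eqP dt.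
have ts : adj t s by rewrite adj_sym.
have yx : adj y x by rewrite adj_sym.
have tri z : dist s z <= (dist t z).+1 /\ dist t z <= (dist s z).+1.
  by rewrite ![dist _ z]dist_sym; split; apply: tree_dist_lip.
have [le1 le2] := tri x; have [le3 le4] := tri y.
have neq_t := adj_dist_neq t xy.
have lip_t := tree_dist_lip t xy; have lip_t' := tree_dist_lip t yx.
have eq1 : dist t x = dist s y by lia.
have eq2 : dist t y = dist s x by lia.
have [/eqP sx0|nsx] := boolP (s == x).
  by subst x; have /tree_dist_eq0 -> : dist t y = 0 by rewrite eq2 tree_distxx.
have [_ _ desc] := tree_dist x; have [p ps dp] := desc s nsx.
have := tree_dist_lip p xy; rewrite ![dist p _]dist_sym => lip_p.
have eq_pt : p = t.
  apply: (@tree_parent_unique y s) => //; rewrite !(dist_sym y);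
  move: (dist_sym p y) (dist_sym s y) (dist_sym t y) (dist_sym p x)
    (dist_sym s x) (dist_sym t x); lia.
subst p; move: (dist_sym t x) (dist_sym s x); lia.
Qed.

End Tree.

(** * Distances in the star-fractal tree *)

(** A function on the star-fractal graph given by f on the old vertices and by h
on the inserted ones, and one more at a pendant vertex than at its centre:
the shape of the distance from any vertex that is not pendant. *)
Definition star_profile (m : nat) (G : sgraph) (f : G -> nat)
    (h : edge G -> nat) (z : star_fractal m G) : nat :=
  match z with
  | inl v => f v
  | inr (inl a) => h a
  | inr (inr (a, _)) => (h a).+1
  end.

Definition center (m : nat) (G : sgraph) (a : edge G) : star_fractal m G :=
  inr (inl a).

Definition leaf (m : nat) (G : sgraph) (a : edge G) (i : 'I_m) :
  star_fractal m G := inr (inr (a, i)).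

(** The pendant vertices satisfy the conditions for a distance function by
construction, which leaves the incidences between vertices and edges of G. *)
Lemma star_profile_distance_from (m : nat) (G : sgraph) (f : G -> nat)
    (h : edge G -> nat) (z0 : star_fractal m G) :
  star_profile f h z0 = 0 ->
  (forall (x : G) (a : edge G), x \in val a -> f x <= (h a).+1 /\ h a <= (f x).+1) ->
  (forall v, inl v != z0 -> exists2 a : edge G, v \in val a & f v = (h a).+1) ->
  (forall a, center m a != z0 -> exists2 x : G, x \in val a & h a = (f x).+1) ->
  distance_from z0 (star_profile f h).
Proof.
move=> z00 lip descV descE; split=> //.
  case=> [x|[a|[a i]]] [y|[b|[b j]]] //=.
  - by case/lip.
  - by case/lip.
  - by move/eqP->.
  - by move/eqP->; rewrite leqW.
case=> [v|[a|[a i]]] neq.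
- by have [a va fv] := descV v neq; exists (center m a).
- by have [x xa ha] := descE a neq; exists (inl x).
- by exists (center m a); rewrite /= ?eqxx.
Qed.

Lemma sum_star (m : nat) (G : sgraph) (F : star_fractal m G -> nat) :
  \sum_z F z = \sum_v F (inl v) + \sum_a F (center m a)
               + \sum_a \sum_i F (leaf a i).
Proof.
rewrite big_sumType big_sumType /= addnA; congr (_ + _).
by rewrite pair_bigA; apply: eq_bigr => -[].
Qed.

Lemma sum_star_profile (m : nat) (G : sgraph) (f : G -> nat)
    (h : edge G -> nat) :
  \sum_z @star_profile m G f h z =
  \sum_v f v + m.+1 * \sum_a h a + m * #|edge G|.
Proof.
rewrite sum_star; have -> : \sum_a \sum_i star_profile f h (leaf a i : star_fractal m G) =
          m * \sum_a h a + m * #|edge G|.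
  rewrite big_distrr mulnC -sum_nat_const -big_split /=.
  by apply: eq_bigr => a _; rewrite sum_nat_const card_ord mulnS addnC.
by rewrite mulSn !addnA.
Qed.

Section StarOfTree.

Variables (m : nat) (T : sgraph) (hT : is_tree T).

(** Along an edge xy with y further from u, the values are 2 d(u,x), then
d(u,x) + d(u,y) = 2 d(u,x) + 1, then 2 d(u,y) = 2 d(u,x) + 2. *)
Lemma vertex_star_distance (u : T) :
  distance_from (inl u : star_fractal m T)
    (star_profile (fun v => 2 * dist u v) (edge_sum (dist u))).
Proof.
apply: star_profile_distance_from => [|z a|v neq|a _] /=.
- by rewrite (tree_distxx hT).
- have [x [y [xy eqa dy]]] := edge_orient hT u a.
  rewrite (edge_sumE _ xy eqa) eqa !inE => /orP [] /eqP ->; lia.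
- have [_ _ desc] := tree_dist hT u; have [w wv dv] := desc v neq.
  have [a eqa] := adj_edge wv; exists a; first by rewrite eqa !inE eqxx orbT.
  by rewrite (edge_sumE _ wv eqa); lia.
- have [x [y [xy eqa dy]]] := edge_orient hT u a.
  exists x; first by rewrite eqa !inE eqxx.
  by rewrite (edge_sumE _ xy eqa); lia.
Qed.

Definition center_vertex (b : edge T) (v : T) : nat :=
  edge_sum (fun s => dist s v) b.

Definition center_center (b a : edge T) : nat :=
  if a == b then 0 else (edge_sum (center_vertex b) a)./2.

Lemma center_vertex_own (b : edge T) (x : T) :
  x \in val b -> center_vertex b x = 1.
Proof.
have [s [t [st eqb]]] := edgeE b; have dt : dist s t = 1.
  have := adj_dist_neq hT s st; have := tree_dist_lip hT s st.
  by rewrite (tree_distxx hT); lia.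
rewrite /center_vertex (edge_sumE _ st eqb) eqb !inE => /orP [] /eqP ->.
  by rewrite (dist_sym t) dt (tree_distxx hT).
by rewrite dt (tree_distxx hT).
Qed.

(** By [parallel_edges] both ends of b are one step further from y than from x. *)
Lemma center_vertex_step (b a : edge T) : a != b ->
  exists x y, [/\ adj x y, val a = [set x; y] &
                  center_vertex b y = center_vertex b x + 2].
Proof.
move=> neq_ab; have [s [t [st eqb]]] := edgeE b.
have [x [y [xy eqa ds]]] := edge_orient hT s a.
exists x, y; split=> //; rewrite /center_vertex !(edge_sumE _ st eqb).
have := parallel_edges hT st xy _ ds; rewrite -eqa -eqb (inj_eq val_inj).
by rewrite eq_sym neq_ab => /(_ isT); lia.
Qed.

(** Along an edge other than b the values on the two ends are k and k + 2, so that
their mean k + 1 fits in between.  Descent from a vertex v outside b follows the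
edge towards one end of b, which by [parallel_edges] also leads towards the
other end. *)
Lemma center_star_distance (b : edge T) :
  distance_from (center m b)
    (star_profile (center_vertex b) (center_center b)).
Proof.
apply: star_profile_distance_from => [|z a|v _|a neq] /=.
- by rewrite /center_center eqxx.
- rewrite /center_center; case: eqVneq => [-> /center_vertex_own -> //|neq].
  have [x [y [xy eqa dy]]] := center_vertex_step neq.
  rewrite (edge_sumE _ xy eqa) eqa !inE => /orP [] /eqP ->; lia.
- have [vb|vnb] := boolP (v \in val b).
    by exists b; rewrite // center_vertex_own // /center_center eqxx.
  have [s [t [st eqb]]] := edgeE b.
  have neq_vs : v != s by apply: contraNneq vnb => ->; rewrite eqb !inE eqxx.
  have [_ _ desc] := tree_dist hT s; have [w wv dv] := desc v neq_vs.
  have [a eqa] := adj_edge wv.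
  have va : v \in val a by rewrite eqa !inE eqxx orbT.
  have neq_ab : a != b by apply: contraNneq vnb => <-.
  have dt : dist t v = (dist t w).+1.
    apply: (parallel_edges hT st wv) => //.
    by rewrite -eqa -eqb (inj_eq val_inj) eq_sym.
  exists a => //; rewrite /center_center (negbTE neq_ab) (edge_sumE _ wv eqa).
  by rewrite /center_vertex !(edge_sumE _ st eqb); lia.
- have neq_ab : a != b by apply: contraNneq neq => ->.
  have [x [y [xy eqa dy]]] := center_vertex_step neq_ab.
  exists x; first by rewrite eqa !inE eqxx.
  by rewrite /center_center (negbTE neq_ab) (edge_sumE _ xy eqa); lia.
Qed.

(** The correction term accounts for a = b, where the mean of the values 1 on the
two ends of b exceeds the distance 0. *)
Lemma center_center_double (b a : edge T) :
  2 * center_center b a + 2 * (a == b) = edge_sum (center_vertex b) a.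
Proof.
rewrite /center_center; case: eqVneq => [->|neq].
  have [s [t [st eqb]]] := edgeE b.
  by rewrite (edge_sumE _ st eqb) !center_vertex_own // eqb !inE eqxx ?orbT.
have [x [y [xy eqa dy]]] := center_vertex_step neq.
by rewrite (edge_sumE _ xy eqa); lia.
Qed.

Lemma leaf_star_distance (b : edge T) (i : 'I_m) :
  distance_from (leaf b i)
    (fun z => if z == leaf b i then 0 else
       (star_profile (center_vertex b) (center_center b) z).+1).
Proof.
apply: pendant_distance_from (center_star_distance b).
by case=> [v|[a|[a j]]] //=; apply/eqP/eqP => [->|[->]].
Qed.

(** * Summing the distances *)

Let n := #|T|.
Let e := #|edge T|.
Let D (u : T) := \sum_v dist u v.
Let W := \sum_u D u.

Lemma card_tree : n = e.+1.
Proof.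
by rewrite /e (card_edge hT) prednK //; case: hT => -[].
Qed.

(** Summing [center_center_double] over a, each end s of b contributes 2 D(s) - e,
so the sum is D(s) + D(t) - e - 1, and e + 1 = n. *)
Lemma sum_center_center (b : edge T) :
  \sum_a center_center b a + n = edge_sum D b.
Proof.
have: \sum_a edge_sum (center_vertex b) a + 2 * e = 2 * edge_sum D b.
  have -> : \sum_a edge_sum (center_vertex b) a =
            edge_sum (fun s => \sum_a edge_sum (dist s) a) b.
    rewrite edge_sum_exchange; apply: eq_bigr => a _; exact: exchange_big.
  have [s [t [st eqb]]] := edgeE b; rewrite !(edge_sumE _ st eqb).
  have := sum_edge_sum_dist hT s; have := sum_edge_sum_dist hT t.
  rewrite -/e -/(D s) -/(D t); lia.
rewrite -(eq_bigr _ (fun a _ => center_center_double b a)) big_split /=.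
have -> : \sum_a 2 * (a == b) = 2.
  by rewrite (bigD1 b) //= eqxx big1 // => a /negbTE ->.
by rewrite -big_distrr /= card_tree; lia.
Qed.

(** By exchanging sums, this is [sum_edge_sum_dist] added up over all vertices. *)
Lemma sum_edge_sum_D : \sum_b edge_sum D b + n * e = 2 * W.
Proof.
have -> : \sum_b edge_sum D b = \sum_(v : T) \sum_b edge_sum (dist v) b.
  rewrite [RHS]exchange_big; apply: eq_bigr => b _; rewrite edge_sum_exchange.
  by apply: eq_bigr => v _; apply: eq_bigr => s _; apply: dist_sym.
rewrite /W big_distrr /= -sum_nat_const -big_split.
by apply: eq_bigr => v _; apply: sum_edge_sum_dist.
Qed.

Lemma vertex_transmission (u : T) :
  \sum_z dist (inl u : star_fractal m T) z + e = (2 * m + 4) * D u.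
Proof.
rewrite (eq_bigr _ (fun z _ => distance_from_dist (vertex_star_distance u) z)).
rewrite sum_star_profile -big_distrr /= -/e -/(D u).
rewrite (_ : 2 * m + 4 = m.+2 * 2); last by lia.
by rewrite -mulnA -(sum_edge_sum_dist hT u) -/e; ring.
Qed.

Lemma center_transmission (b : edge T) :
  \sum_z dist (center m b) z + m.+1 * n = m.+2 * edge_sum D b + m * e.
Proof.
rewrite (eq_bigr _ (fun z _ => distance_from_dist (center_star_distance b) z)).
rewrite sum_star_profile -edge_sum_exchange -/e -[edge_sum _ b]/(edge_sum D b).
by rewrite -(sum_center_center b); ring.
Qed.

(** Each distance exceeds the one from the centre by one, except that from the
pendant vertex to itself, which is 0 rather than 2. *)
Lemma leaf_transmission (b : edge T) (i : 'I_m) :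
  \sum_z dist (leaf b i) z + 2 =
  \sum_z dist (center m b) z + #|star_fractal m T|.
Proof.
rewrite (eq_bigr _ (fun z _ => distance_from_dist (leaf_star_distance b i) z)).
rewrite [in RHS](eq_bigr _
  (fun z _ => distance_from_dist (center_star_distance b) z)).
rewrite -sum1_card -big_split (bigD1 (leaf b i)) // [in RHS](bigD1 (leaf b i)) //=.
rewrite eqxx /center_center eqxx addnC add0n; congr (_ + _).
by apply: eq_bigr => z /negbTE ->; rewrite addn1.
Qed.

Lemma card_star : #|star_fractal m T| = n + e + e * m.
Proof. by rewrite !card_sum card_prod card_ord addnA. Qed.

End StarOfTree.

Local Open Scope ring_scope.

Theorem theorem3 (m : nat) (T : sgraph) (hT : is_tree T) :
  (geodesic_distance (star_fractal m T))%:Z =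
    2%:Z * (m%:Z + 2) ^+ 2 * (geodesic_distance T)%:Z
    - (m%:Z + 2) * (#|T|%:Z - 1) * (m%:Z + #|T|%:Z).
Proof.
have star0 (z : star_fractal m T) : dist z z = 0%N.
  case: z => [u|[b|[b i]]].
  - by rewrite (distance_from_dist (vertex_star_distance m hT u)) /= (tree_distxx hT).
  - by rewrite (distance_from_dist (center_star_distance m hT b)) /center_center /= eqxx.
  - by rewrite (distance_from_dist (leaf_star_distance hT b i)) eqxx.
have := sum_dist star0; have := sum_dist (tree_distxx hT).
rewrite sum_star.
have := sum_edge_sum_D hT; have cardT := card_tree hT.
set X := (\sum_b _)%N; set W := (\sum_u _)%N => sumX sumW.
set S1 := (\sum_v _)%N; set S2 := (\sum_a _)%N; set S3 := (\sum_a _)%N => sumS.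
have sum1 : (S1 + #|T| * #|edge T| = (2 * m + 4) * W)%N.
  rewrite -sum_nat_const -big_split /= /W big_distrr.
  by apply: eq_bigr => u _; apply: vertex_transmission.
have sum2 : (S2 + #|edge T| * (m.+1 * #|T|) =
             m.+2 * X + #|edge T| * (m * #|edge T|))%N.
  rewrite -!sum_nat_const -big_split /= /X big_distrr -big_split /=.
  by apply: eq_bigr => b _; apply: center_transmission.
have sum3 : (S3 + #|edge T| * (m * 2) =
             m * S2 + #|edge T| * (m * #|star_fractal m T|))%N.
  rewrite -!sum_nat_const -big_split /= /S2 big_distrr -big_split /=.
  apply: eq_bigr => b _; rewrite -mulnDr.
  transitivity (\sum_(i < m) (\sum_z dist (leaf b i) z + 2))%N.
    by rewrite big_split sum_nat_const card_ord.
  rewrite (eq_bigr _ (fun i _ => leaf_transmission hT b i)).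
  by rewrite sum_nat_const card_ord.
rewrite card_star in sum3.
move: (geodesic_distance _) (geodesic_distance _) sumS sumW sumX sum1 sum2 sum3.
move: S1 S2 S3 X W => S1 S2 S3 X W S' S; rewrite cardT.
move: #|edge T| => e sumS sumW sumX sum1 sum2 sum3.
nia.
Qed.
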